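(* Let $A,B,d_*>0$ be real numbers with $B\ge A$, and let $I$ be a non-empty set. Suppose that $x_n:I\to[0,\infty)$ for $n\ge0$, and that real-valued functions $d_n$ and $r_n$ on $I$ ($n\ge1$) satisfy $$A\,x_{n-1}(t)^2=d_n(t)x_n(t)+B\,x_n(t)x_{n+1}(t)+r_n(t),\qquad n\ge1,\ t\in I,$$ with $d_n(t)\ge d_*$ for every $n\ge1$ and $t\in I$. Assume also that $$\lim_{n\to\infty}\sup_{t\in I}|r_n(t)|=0,\qquad \sup_{t\in I}x_k(t)<\infty\ \text{ for every fixed }k\ge0.$$ Then $$\lim_{n\to\infty}\sup_{t\in I}x_n(t)=0.$$
   Context: $I$ is an arbitrary non-empty parameter set; no topology, measure or regularity in the parameter $t$ is assumed. *)

(* Defs.v *)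
From mathcomp Require Import all_boot all_order all_algebra.
From mathcomp Require Import all_classical all_reals all_analysis.

Set Implicit Arguments.
Unset Strict Implicit.
Unset Printing Implicit Defensive.

Import Order.TTheory GRing.Theory Num.Theory.

Local Open Scope classical_set_scope.
Local Open Scope ring_scope.

(* The supremum is extended-real valued: for real-valued data it may well be
   +oo at finitely many indices even when it tends to 0. *)
Definition sup_over (R : realType) (I : Type) (f : I -> R) : \bar R :=
  ereal_sup (range (fun t => (f t)%:E)).

(* Main.v *)
(* Multiplying the recursion by x_n and using A <= B, the quantity
   V_n = A x_{n-1}^2 x_n satisfies V_{n+1} <= V_n - dstar x_n^2 + |r_n| x_n.
   Once |r_n| <= dstar eta / 2, it drops by at least dstar eta^2 / 2 as long as
   x_n > eta; being nonnegative and initially bounded uniformly in t, it forces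
   x_n(t) <= eta within a number of steps independent of t.  For
   eta <= dstar / (2 A) the bound dstar x_n <= A x_{n-1}^2 + |r_n| then
   propagates x_n <= eta forever. *)
Require Import Defs.
From mathcomp Require Import all_boot all_order all_algebra.
From mathcomp Require Import lra.
From mathcomp Require Import all_classical all_reals all_analysis.

Set Implicit Arguments.
Unset Strict Implicit.
Unset Printing Implicit Defensive.

Import Order.TTheory GRing.Theory Num.Theory.
Import numFieldNormedType.Exports.

Local Open Scope classical_set_scope.
Local Open Scope ring_scope.

Lemma sup_over_ge (R : realType) (I : Type) (f : I -> R) (t : I) :
  ((f t)%:E <= sup_over f)%E.
Proof. by apply: ereal_sup_ubound; exists t. Qed.

Lemma sup_over_le (R : realType) (I : Type) (f : I -> R) (M : R) :
  (forall t, f t <= M) -> (sup_over f <= M%:E)%E.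
Proof. by move=> fM; apply: ge_ereal_sup => _ [t _ <-]; rewrite lee_fin. Qed.

Lemma sup_over_lty_bounded (R : realType) (I : Type) (f : I -> R) :
  (sup_over f < +oo)%E -> exists2 M, 0 <= M & forall t, f t <= M.
Proof.
move=> f_fin; exists `|fine (sup_over f)|; first exact: normr_ge0.
move=> t; have := sup_over_ge f t.
case: (sup_over f) f_fin => [M||]//= _; rewrite lee_fin => ftM.
exact: le_trans ftM (ler_norm _).
Qed.

(** Trades extended-real convergence for a uniform epsilon statement. A point of [I] and [f_ge0]
    make every supremum nonnegative, so a uniform real bound from some index on makes the suprema
    finite from there. *)
Lemma sup_over_cvg0P (R : realType) (I : Type) (f : nat -> I -> R) :
  [set: I] !=set0 -> (forall n t, 0 <= f n t) ->
  sup_over (f n) @[n --> \oo] --> 0%E <->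
  forall e : R, 0 < e -> exists N, forall n t, (N <= n)%N -> f n t <= e.
Proof.
move=> [t0 _] f_ge0.
have sup_ge0 n : (0 <= sup_over (f n))%E.
  by apply: le_trans (sup_over_ge _ t0); rewrite lee_fin.
split=> [/fine_cvgP[fin_sup /cvgrPdist_le sup0] e e_gt0|f0].
  have [N _ HN] : \forall n \near \oo,
      sup_over (f n) \is a fin_num /\ `|0 - fine (sup_over (f n))| <= e.
    by apply: filterI; [exact: fin_sup | exact: sup0].
  exists N => n t /HN [fin_n].
  rewrite sub0r normrN ger0_norm ?fine_ge0// => le_e.
  by rewrite (le_trans _ le_e)// -lee_fin fineK// sup_over_ge.
have sup_fin (n : nat) (e : R) :
    (forall t, f n t <= e) -> sup_over (f n) \is a fin_num.
  move=> /sup_over_le le_e.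
  by rewrite ge0_fin_numE//; apply: le_lt_trans le_e (ltry _).
apply/fine_cvgP; split.
  have [N HN] := f0 1 ltr01; exists N => // n /= Nn.
  by apply: (sup_fin _ 1) => t; exact: HN.
apply/cvgrPdist_le => e /f0[N HN]; exists N => // n /= Nn.
have le_e t : f n t <= e by exact: HN.
rewrite sub0r normrN ger0_norm ?fine_ge0//.
by rewrite -lee_fin fineK ?(sup_fin _ e)// sup_over_le.
Qed.

Section Recursion.
Variables (R : realType) (A a eta : R).
Hypotheses (A_gt0 : 0 < A) (a_gt0 : 0 < a) (eta_gt0 : 0 < eta).
Variables (y : nat -> R) (N : nat).
Hypothesis y_ge0 : forall n, 0 <= y n.
(** The form the recursion takes at a fixed parameter, with [a] in the role of [dstar], once the
    remainder is at most [a * eta / 2]. *)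
Hypothesis y_rec : forall n, (N <= n)%N ->
  a * y n.+1 + A * y n.+1 * y n.+2 <= A * y n ^+ 2 + a * eta / 2.

(** Dropping the product term, [y n <= eta] gives [a * y n.+1 <= A * eta ^+ 2 + a * eta / 2 <= a *
    eta]. *)
Lemma rec_below_stable : 2 * A * eta <= a ->
  forall m n, (N <= m <= n)%N -> y m <= eta -> y n <= eta.
Proof.
move=> eta_small m n /andP[Nm /subnK <-] ym; elim: (n - m)%N => //= k IHk.
rewrite addSn; have := y_rec (leq_trans Nm (leq_addl k m)).
set u := y (k + m)%N in IHk *; set v := y _.+1; set w := y _.+2 => uvw.
have u_ge0 : 0 <= u by exact: y_ge0.
have vw_ge0 : 0 <= A * v * w by rewrite !mulr_ge0// ?y_ge0// ltW.
have u2 : A * u ^+ 2 <= a * eta / 2.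
  have : A * u ^+ 2 <= A * eta ^+ 2.
    by rewrite ler_pM2l// ler_pXn2r// nnegrE ltW.
  have : 2 * A * eta * eta <= a * eta by rewrite ler_pM2r.
  lra.
rewrite -(ler_pM2l a_gt0); lra.
Qed.

Lemma lyapunov_decay k : (forall n, (N < n <= N + k)%N -> eta < y n) ->
  A * y (N + k) ^+ 2 * y (N + k).+1 + k%:R * (a * eta ^+ 2 / 2) <=
  A * y N ^+ 2 * y N.+1.
Proof.
elim: k => [_|k IHk y_big]; first by rewrite addn0 mul0r addr0.
have {}IHk : A * y (N + k) ^+ 2 * y (N + k).+1 + k%:R * (a * eta ^+ 2 / 2) <=
    A * y N ^+ 2 * y N.+1.
  by apply: IHk => n /andP[Nn nk]; rewrite y_big// Nn addnS leqW.
apply: le_trans IHk; rewrite addnS -natr1.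
have := y_rec (leq_addr k N).
have : eta < y (N + k).+1 by rewrite y_big// addnS ltnS leq_addr leqnn.
set u := y (N + k); set v := y _; set w := y _ => v_big.
(* Multiplying the recursion by [v > 0] produces the consecutive values [A * u ^+ 2 * v] and
   [A * v ^+ 2 * w] of the Lyapunov quantity. *)
rewrite -(ler_pM2r (lt_trans eta_gt0 v_big)) => uvw.
(* The drop is at least [a * v * (v - eta / 2)], and both [v] and [2 * v - eta] are at least
   [eta]. *)
have : a * (eta * eta) <= a * (v * (2 * v - eta)).
  have eta_ge0 := ltW eta_gt0; have v_ge := ltW v_big.
  rewrite ler_pM2l//; apply: ler_pM => //; lra.
lra.
Qed.

(** Otherwise [K] successive drops would exceed the initial value, although the quantity stays
    nonnegative. [K] depends on the trajectory only through the bound [M], whence uniformity in the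
    parameter. *)
Lemma rec_hits_below M K :
  A * y N ^+ 2 * y N.+1 <= M -> M < K%:R * (a * eta ^+ 2 / 2) ->
  exists2 n, (N < n <= N + K)%N & y n <= eta.
Proof.
move=> V_le M_lt; apply: contrapT => /forall2NP y_big.
have : A * y (N + K) ^+ 2 * y (N + K).+1 + K%:R * (a * eta ^+ 2 / 2) <=
    A * y N ^+ 2 * y N.+1.
  apply: lyapunov_decay => n nK.
  by case: (y_big n) => [//|/negP]; rewrite -ltNge.
have : 0 <= A * y (N + K) ^+ 2 * y (N + K).+1.
  by rewrite !mulr_ge0 ?exprn_ge0// ltW.
lra.
Qed.

End Recursion.

Theorem lemma3p6 (R : realType) (A B dstar : R) (I : Type)
    (x d r : nat -> I -> R)
    (A_gt0 : 0 < A) (B_gt0 : 0 < B) (dstar_gt0 : 0 < dstar) (leAB : A <= B)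
    (I_neq0 : [set: I] !=set0)
    (x_ge0 : forall (n : nat) (t : I), 0 <= x n t)
    (rec : forall (n : nat) (t : I), (1 <= n)%N ->
      A * x n.-1 t ^+ 2 = d n t * x n t + B * x n t * x n.+1 t + r n t)
    (d_ge : forall (n : nat) (t : I), (1 <= n)%N -> dstar <= d n t)
    (r_cvg : sup_over (fun t => `|r n t|) @[n --> \oo] --> 0%E)
    (x_bnd : forall k : nat, (sup_over (x k) < +oo)%E) :
  sup_over (x n) @[n --> \oo] --> 0%E.
Proof.
have r0 (e : R) : 0 < e -> exists N, forall n t, (N <= n)%N -> `|r n t| <= e.
  by move: e; apply/sup_over_cvg0P.
apply/sup_over_cvg0P => // e e_gt0.
(* The first entry serves the target accuracy, the second the stability condition
   [2 * A * eta <= dstar]. *)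
pose eta := Num.min e (dstar / (2 * A)).
have eta_gt0 : 0 < eta by rewrite lt_min e_gt0 divr_gt0// mulr_gt0.
have eta_small : 2 * A * eta <= dstar.
  by rewrite mulrC -ler_pdivlMr ?mulr_gt0// ge_min lexx orbT.
have [|N HN] := r0 (dstar * eta / 2); first by rewrite !(divr_gt0, mulr_gt0).
have x_rec n t : (N <= n)%N -> dstar * x n.+1 t + A * x n.+1 t * x n.+2 t <=
    A * x n t ^+ 2 + dstar * eta / 2.
  move=> Nn; rewrite (rec n.+1 t)//=.
  have /ler_normlP[r_ge _] := HN n.+1 t (leqW Nn).
  have : dstar * x n.+1 t <= d n.+1 t * x n.+1 t by rewrite ler_wpM2r// d_ge.
  have : A * (x n.+1 t * x n.+2 t) <= B * (x n.+1 t * x n.+2 t).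
    by rewrite ler_wpM2r// mulr_ge0.
  lra.
(* Bounds at the two starting indices control the initial Lyapunov value for all [t] at once. *)
have [M0 M0_ge0 x_le0] := sup_over_lty_bounded (x_bnd N).
have [M1 M1_ge0 x_le1] := sup_over_lty_bounded (x_bnd N.+1).
pose q := dstar * eta ^+ 2 / 2.
have q_gt0 : 0 < q by rewrite divr_gt0// mulr_gt0// exprn_gt0.
pose K := Num.bound (A * M0 ^+ 2 * M1 / q).
have K_big : A * M0 ^+ 2 * M1 < K%:R * q.
  rewrite -ltr_pdivrMr//; apply: archi_boundP.
  by rewrite divr_ge0 ?mulr_ge0 ?exprn_ge0// ltW.
exists (N + K)%N => n t NKn.
have V_le : A * x N t ^+ 2 * x N.+1 t <= A * M0 ^+ 2 * M1.
  rewrite ler_pM ?mulr_ge0 ?exprn_ge0 ?(ltW A_gt0)//.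
  by rewrite ler_pM2l// ler_pXn2r ?nnegrE.
have xt_rec m := x_rec m t.
(* The hitting index [m] may vary with [t], but [m <= N + K <= n], so stability carries the bound
   from [m] to [n]. *)
have [m /andP[Nm mNK] xm_le] :=
  rec_hits_below A_gt0 dstar_gt0 eta_gt0 (x_ge0^~ t) xt_rec V_le K_big.
apply: (@le_trans _ _ eta); last by rewrite ge_min lexx.
apply: (rec_below_stable A_gt0 dstar_gt0 eta_gt0 (x_ge0^~ t) xt_rec eta_small _
  xm_le).
by rewrite (ltnW Nm) (leq_trans mNK).
Qed.
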